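(* Let $p$ be an odd prime and $k\in\mathbb{N}$ with $2\le k\le\frac{p-1}{2}$ such that $p\equiv 1\pmod{2k}$. Let $\alpha_1,\ldots,\alpha_{(p-1)/k}$ be the distinct $k$-th power residues modulo $p$ and let $T\left(\frac{p-1}{k}\right)=\prod_{1\le i<j\le\frac{p-1}{k}}(\alpha_i-\alpha_j)$. (a) If $p\equiv 1\pmod{4k}$, then $$\left(\frac{\sqrt{S_{1+\frac{p-1}{k},k}(-1,p)}}{p}\right)=\left(\frac{(k-1)(2k-1)}{p}\right)\left(\frac{\frac{p-1}{k}!!}{p}\right)\left(\frac{T\left(\frac{p-1}{k}\right)}{p}\right).$$ (b) If $k$ is even and $p\equiv 2k+1\pmod{4k}$, then $$\left(\frac{\sqrt{S_{1+\frac{p-1}{k},k}(-1,p)}}{p}\right)=\begin{cases}\left(\frac{T\left(\frac{p-1}{k}\right)}{p}\right), & \text{if } p=2k+1;\\[4pt] \left(\frac{k(2k-1)}{p}\right)\left(\frac{\left(\frac{p-1}{k}-1\right)!!}{p}\right)\left(\frac{T\left(\frac{p-1}{k}\right)}{p}\right), & \text{otherwise.}\end{cases}$$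
   Context: For an odd prime $p$ and an integer $k\ge 2$ with $k\mid p-1$, the $\alpha_i$ $(1\le i\le\frac{p-1}{k})$ are integers representing the distinct (nonzero) $k$-th power residues modulo $p$, and for $n\in\mathbb{N}$, $d\in\mathbb{Z}$, $$S_{n,k}(d,p)=\det\left[(\alpha_i+d\,\alpha_j)^n\right]_{1\le i,j\le \frac{p-1}{k}}.$$ When $p\equiv 1\pmod{2k}$ and $n$ is odd, $S_{n,k}(-1,p)$ is the determinant of a skew-symmetric integer matrix of even order, hence the square of an integer, and $\sqrt{S_{n,k}(-1,p)}$ denotes its integer square root (the sign is immaterial inside the Legendre symbol when $p\equiv 1\pmod 4$, which is so in all the cases considered). $\left(\frac{\cdot}{p}\right)$ is the Legendre symbol. For $a\in\mathbb{N}$, $a!!$ is the double factorial: $a!!=a\cdot(a-2)!!$ if $a>2$ and $a!!=a$ if $a\in\{1,2\}$; $\frac{p-1}{k}!!$ means $\left(\frac{p-1}{k}\right)!!$. *)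

(* Defs.v *)
From mathcomp Require Import all_boot all_order all_algebra.

Set Implicit Arguments.
Unset Strict Implicit.
Unset Printing Implicit Defensive.

Import Order.TTheory GRing.Theory Num.Theory.
Local Open Scope ring_scope.

Definition legendre (a : int) (p : nat) : int :=
  if (p %| a)%Z then 0
  else if [exists x : 'I_p, (x%:Z ^+ 2 == a %[mod p])%Z] then 1 else -1.

(* [double_fact 0 = 1], so that [double_fact 2 = 2]. *)
Fixpoint double_fact (a : nat) : nat :=
  if a is b.+2 then (a * double_fact b)%N else 1%N.

(* The nonnegative square root of a perfect square; the value is 0 when [z] is
   not the square of an integer. *)
Definition sqrtz (z : int) : int :=
  (\max_(s < `|z|%N.+1 | s%:Z ^+ 2 == z) s)%N%:Z.

Lemma sqrtz_sqr (s : int) : sqrtz (s ^+ 2) = `|s|.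
Proof.
have sqE (t : nat) : (t%:Z ^+ 2 == s ^+ 2) = (t == `|s|%N).
  by rewrite -[s ^+ 2]real_normK ?num_real // eqrXn2 // -abszE.
rewrite /sqrtz -[RHS]abszE; congr Posz.
have lt_s : (`|s| < `|(s ^+ 2)%R|.+1)%N.
  by rewrite ltnS abszX; case: `|s|%N => // n; rewrite leq_pmulr.
by rewrite (big_pred1 (Ordinal lt_s)) // => t; rewrite /= sqE.
Qed.

Definition kth_power_residue (p k : nat) (a : int) : Prop :=
  ~~ (p %| a)%Z /\ exists x : int, (x ^+ k = a %[mod p])%Z.

(* The integers [alpha i] form a complete irredundant system of representatives,
   in an arbitrary order, of the classes mod [p] of the k-th power residues. *)
Definition lists_kth_power_residues (p k m : nat) (alpha : 'I_m -> int) : Prop :=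
  (forall i j, (alpha i = alpha j %[mod p])%Z -> i = j) /\
  (forall a : int,
     kth_power_residue p k a <-> exists i, (a = alpha i %[mod p])%Z).

Definition S_det (m : nat) (alpha : 'I_m -> int) (n : nat) (d : int) : int :=
  \det (\matrix_(i < m, j < m) (alpha i + d * alpha j) ^+ n).

Definition T_prod (m : nat) (alpha : 'I_m -> int) : int :=
  \prod_(i < m) \prod_(j < m | (i < j)%N) (alpha i - alpha j).

(* Main.v *)
(* Put m = (p - 1) / k = 2 h and N = m + 1.  The k-th power residues are the
   m-th roots of unity in F_p, so pairing the terms r and N - r of the binomial
   expansion of (x - y)^N and reducing exponents with x^m = y^m = 1 gives
     (x - y)^N = (m + 2) (x - y)
        + sum_{2 <= r <= h} (-1)^r C(N, r) (x^(N-r) y^r - x^r y^(N-r)).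
   The exponents occurring on the right are 0, ..., m - 1, each in one pair, so
   the matrix factors as M J M^T with M a column permutation of a Vandermonde
   matrix and J a skew matrix with two antidiagonal blocks.  Hence modulo p its
   determinant is the square of T (m + 2) prod_{2 <= r <= h} (+-) C(N, r); signs
   do not matter as p = 1 mod 4.  The integer square root exists because the
   determinant of a skew-symmetric matrix is a square.  Finally
   prod_r C(N, r) = N!^(h-1) / ((m - 1)!! B^2) for some integer B, while
   k m = -1 mod p turns m + 1 and m + 2 into (k - 1) / k and (2 k - 1) / k. *)
Require Import Defs.
From mathcomp Require Import all_boot all_order all_algebra.
From mathcomp Require Import all_fingroup all_solvable all_field.
From mathcomp Require Import zify ring.

Set Implicit Arguments.
Unset Strict Implicit.
Unset Printing Implicit Defensive.

Import Order.TTheory GRing.Theory Num.Theory.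

(** * Double factorials and the product of binomial coefficients *)

Lemma double_factE n : double_fact n.+2 = (n.+2 * double_fact n)%N.
Proof. by []. Qed.

Lemma fact_double_fact n : (n.+1)`! = (double_fact n.+1 * double_fact n)%N.
Proof. by elim: n => // n IHn; rewrite factS IHn double_factE; ring. Qed.

(** Pair (2j)! with (2j + 1)! = (2j + 1) (2j)!: each pair contributes a square and an odd factor 2j
    + 1, and these odd factors make up the double factorial. *)
Lemma prod_fact_double_fact h :
  \prod_(2 <= j < h.+1.*2) j`! =
    (\prod_(1 <= j < h.+1) (j.*2)`!) ^ 2 * double_fact h.*2.+1.
Proof.
elim: h => [|h IHh]; first by rewrite !big_geq.
have -> : double_fact h.+1.*2.+1 = h.*2.+3 * double_fact h.*2.+1 by [].
move: (double_fact _) IHh => D IHh; rewrite [h.+2.*2]doubleS.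
do 2!rewrite [in LHS]big_nat_recr //=; rewrite [in RHS]big_nat_recr //= {}IHh.
rewrite [(h.+1.*2.+1)`!]factS doubleS expnMn -[2]/1.+1 !expnS !expn0; ring.
Qed.

(** Multiply C(N, r) r! (N - r)! = N! over r, with N = 2h + 3: as r runs over 2, ..., h + 1, the
    numbers r and N - r run once over 2, ..., 2h + 1. *)
Lemma prod_bin_double_fact h :
  (\prod_(2 <= r < h.+2) 'C(h.+1.*2.+1, r)) *
    ((\prod_(1 <= j < h.+1) (j.*2)`!) ^ 2 * double_fact h.*2.+1) =
  (h.+1.*2.+1)`! ^ h.
Proof.
rewrite -prod_fact_double_fact.
have -> : \prod_(2 <= j < h.+1.*2) j`! =
    \prod_(2 <= r < h.+2) (r`! * (h.+1.*2.+1 - r)`!).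
  rewrite big_split /= (big_cat_nat (n := h.+2)) ?doubleS //=; last by lia.
  congr (_ * _); rewrite big_nat_rev /=.
  rewrite (big_addn 0 _ h.+2) (big_addn 0 _ 2).
  have -> : h.*2.+2 - h.+2 = h.+2 - 2 by lia.
  by apply: eq_big_nat => i ih; congr _`!; lia.
rewrite -big_split /= (eq_big_nat _ _ (F2 := fun=> (h.+1.*2.+1)`!)).
  by rewrite prod_nat_const_nat subn2.
by move=> r /andP[_ hr]; apply: bin_fact; lia.
Qed.

Local Open Scope ring_scope.

(** * Skew-symmetric determinants are squares *)

Lemma det_block_schur (F : fieldType) n1 n2 (A : 'M[F]_n1) B C (D : 'M[F]_n2) :
  A \in unitmx ->
  \det (block_mx A B C D) = \det A * \det (D - C *m invmx A *m B).
Proof.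
move=> uA.
have -> : block_mx A B C D =
    block_mx 1%:M 0 (C *m invmx A) 1%:M *m block_mx A B 0 (D - C *m invmx A *m B).
  rewrite mulmx_block !mul1mx ?mul0mx ?mulmx0 ?addr0 mulmxKV //.
  by rewrite addrC subrK.
by rewrite det_mulmx det_lblock det_ublock !det1 !mul1r.
Qed.

Lemma det_mx22 (R : comPzRingType) (A : 'M[R]_2) :
  \det A = A 0 0 * A 1 1 - A 0 1 * A 1 0.
Proof.
rewrite (expand_det_row _ 0) !big_ord_recl big_ord0 /cofactor !det_mx11 !mxE.
have -> : lift 0 0 = 1 :> 'I_2 by apply: val_inj.
have -> : lift 1 0 = 0 :> 'I_2 by apply: val_inj.
by rewrite addr0 expr0 mul1r expr1 mulN1r mulrN.
Qed.

Lemma det_skew_square (F : numFieldType) n (A : 'M[F]_n) :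
  A^T = - A -> exists s, \det A = s ^+ 2.
Proof.
elim/ltn_ind: n A => -[|[|n]] IHn A skewA.
- by exists 1; rewrite det_mx00 expr1n.
- exists 0; rewrite det_mx11 expr0n /=; apply/eqP.
  by rewrite -eqNr; move/matrixP/(_ 0 0): skewA; rewrite !mxE => <-.
have [j nzA | A0] := pickP (fun j => A 0 j != 0); last first.
  exists 0; rewrite expr0n /= (expand_det_row _ 0) big1 // => j _.
  by move/negbFE/eqP: (A0 j) => ->; rewrite mul0r.
pose s : 'S_(2 + n) := tperm 1 j.
pose B := row_perm s (col_perm s A) : 'M_(2 + n).
(* Rows and columns undergo the same permutation, so its sign cancels. *)
have detB : \det B = \det A.
  rewrite /B row_permE col_permE !det_mulmx !det_perm mulrCA.
  by rewrite odd_permV -signr_addb addbb mulr1.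
have skewE i k : A i k = - A k i by move/matrixP/(_ k i): skewA; rewrite !mxE.
have diag0 i : A i i = 0.
  by apply/eqP; rewrite -eqNr -skewE.
have j0 : j != 0 by apply: contraNneq nzA => ->; rewrite diag0.
have skewB : B^T = - B by apply/matrixP => i k; rewrite !mxE skewE.
rewrite -detB -[B](@submxK _ 2 n 2 n).
move: skewB; rewrite -{1 2}[B](@submxK _ 2 n 2 n) tr_block_mx opp_block_mx.
case/(@eq_block_mx _ 2 n 2 n) => skewJ tC tB skewD.
set J := ulsubmx B in skewJ *; set C := dlsubmx B in tC tB *.
set U := ursubmx B in tC tB *; set D := drsubmx B in skewD *.
(* [s] moved a nonzero entry of row 0 to position (0, 1), so the leading 2 x 2
   block J is invertible and its Schur complement is skew-symmetric again. *)
have detJ : \det J = (A 0 j) ^+ 2.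
  have s0 : s 0 = 0 by rewrite tpermD // eq_sym.
  have s1 : s 1 = j by rewrite tpermL.
  rewrite det_mx22 !mxE.
  have -> : lshift n 0 = 0 :> 'I_(2 + n) by apply: val_inj.
  have -> : lshift n 1 = 1 :> 'I_(2 + n) by apply: val_inj.
  by rewrite s0 s1 !diag0 (skewE j 0); ring.
have uJ : J \in unitmx by rewrite unitmxE detJ unitfE expf_neq0.
rewrite det_block_schur //.
have [|t ->] := IHn n (leqnSn _) (D - C *m invmx J *m U).
  rewrite linearB /= !trmx_mul trmx_inv skewJ skewD tC tB.
  have -> : invmx (- J) = - invmx J.
    by rewrite -[- J]scaleN1r invmxZ ?unitmxZ ?unitrN1 // invrN1 scaleN1r.
  by rewrite !mulNmx !mulmxN !opprK !mulmxA opprB addrC.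
by exists (A 0 j * t); rewrite detJ exprMn.
Qed.

(** A rational square root of an integer is integral. This brings the root obtained by elimination
    over a field back to the integers. *)
Lemma int_square_rat (z : int) (q : rat) :
  z%:~R = q ^+ 2 -> exists s : int, z = s ^+ 2.
Proof.
move=> zq; have nzd : (denq q)%:~R != 0 :> rat by rewrite intr_eq0 denq_eq0.
have /(intr_inj (R := rat)) e : (z * denq q ^+ 2)%:~R = (numq q ^+ 2)%:~R :> rat.
  by rewrite rmorphM !rmorphXn /= zq -exprMn -{1}[q]divq_num_den divfK.
have /dvdzP[s es] : (denq q %| numq q)%Z.
  rewrite dvdzE -(@dvdn_pexp2r _ _ 2) // -!abszX -e abszM.
  exact: dvdn_mull.
exists s; apply: (@mulIf _ (denq q ^+ 2)); first by rewrite expf_neq0 ?denq_eq0.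
by rewrite e es exprMn.
Qed.

Lemma det_skew_int_square n (A : 'M[int]_n) :
  A^T = - A -> exists s : int, \det A = s ^+ 2.
Proof.
move=> skewA; have [|q e] := @det_skew_square rat n (map_mx intr A).
  by rewrite map_trmx skewA map_mxN.
by apply: (@int_square_rat _ q); rewrite -e det_map_mx.
Qed.

(** * The determinant of (x_i - x_j)^N for roots of unity *)

Lemma odd_exprB (R : comPzRingType) (x y : R) h :
  (x - y) ^+ h.*2.+1 =
  \sum_(0 <= r < h.+1) (-1) ^+ r * 'C(h.*2.+1, r)%:R *
    (x ^+ (h.*2.+1 - r) * y ^+ r - x ^+ r * y ^+ (h.*2.+1 - r)).
Proof.
rewrite exprBn -(big_mkord xpredT (fun i =>
  (-1) ^+ i * x ^+ (h.*2.+1 - i) * y ^+ i *+ 'C(h.*2.+1, i))).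
rewrite (big_cat_nat (n := h.+1)) /=; [| by [] | by lia].
rewrite [X in _ + X]big_nat_rev /= (big_addn 0 _ h.+1).
have -> : (h.*2.+2 - h.+1 = h.+1)%N by lia.
rewrite -big_split /=; apply: eq_big_nat => r /= hr.
have -> : (h.+1 + h.*2.+2 - (r + h.+1).+1 = h.*2.+1 - r)%N by lia.
rewrite bin_sub; last by lia.
rewrite subKn; last by lia.
have -> : (-1) ^+ (h.*2.+1 - r) = - (-1) ^+ r :> R.
  rewrite -signr_odd oddB; last by lia.
  rewrite /= odd_double /= -[in RHS](signr_odd _ r).
  by case: (odd r); rewrite /= ?expr0 ?expr1 ?opprK.
by rewrite -[X in X + _]mulr_natr -[X in _ + X]mulr_natr; ring.
Qed.

(* The i-th pair of exponents, and its coefficient: i = 0 is the merged pair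
   (1, 0) of the terms r = 0, 1, and i > 0 stands for r = i + 1; half the
   order, (p - 1) / (2 k), is [h.+1]. *)
Definition expL h (i : nat) : nat := if i is 0 then 1 else (h.+1.*2 - i)%N.
Definition expR (i : nat) : nat := if i is 0 then 0 else i.+1.
Definition coefLR (R : pzRingType) h (i : nat) : R :=
  if i is 0 then h.+1.*2.+2%:R else (-1) ^+ i.+1 * 'C(h.+1.*2.+1, i.+1)%:R.

Lemma odd_exprB_unity (R : comPzRingType) (x y : R) h :
  x ^+ h.+1.*2 = 1 -> y ^+ h.+1.*2 = 1 ->
  (x - y) ^+ h.+1.*2.+1 =
  \sum_(i < h.+1) coefLR R h i *
    (x ^+ expL h i * y ^+ expR i - x ^+ expR i * y ^+ expL h i).
Proof.
move=> x1 y1; rewrite odd_exprB.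
(* With m = N - 1 and x^m = y^m = 1, the terms r = 0 and r = 1 become x - y and N (x - y); they
   merge into the coefficient N + 1 = m + 2. *)
rewrite big_nat_recl // big_nat_recl // big_mkord big_ord_recl /= addrA.
congr (_ + _).
move: h.+1.*2 x1 y1 => n x1 y1.
rewrite subn0 subn1 bin0 bin1 [n.+1.-1]/= !exprS x1 y1 !expr0 -!natr1.
by ring.
Qed.

Definition expLR h (i : 'I_(h.+1 + h.+1)) : nat :=
  match split i with inl a => expL h a | inr b => expR b end.

Lemma expLR_ltn h (i : 'I_(h.+1 + h.+1)) : (expLR i < h.+1 + h.+1)%N.
Proof. by rewrite /expLR; case: (split i) => -[[|a] lt_a] /=; lia. Qed.

(** The left exponents are 1 and h + 2, ..., 2h + 1, the right ones 0 and 2, ..., h + 1: together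
    each of 0, ..., m - 1 once. *)
Lemma expLR_inj h : injective (@expLR h).
Proof.
move=> i j; rewrite /expLR -[i]splitK -[j]splitK !unsplitK.
case: (split i) (split j) => a [] b /=; move: (ltn_ord a) (ltn_ord b);
  case: a b => [[|a] ?] [[|b] ?] /= lta ltb e;
  try (congr lshift || congr rshift; apply: val_inj => /=); lia.
Qed.

Lemma det_block_antidiag (R : comNzRingType) n (D : 'M[R]_n) :
  \det (block_mx 0 D (- D) 0) = \det D ^+ 2.
Proof.
(* The last three factors multiply to [[0, 1], [-1, 0]]. *)
have -> : block_mx 0 D (- D) 0 =
    block_mx D 0 0 D *m (block_mx 1%:M 1%:M 0 1%:M *m
      block_mx 1%:M 0 (- 1%:M) 1%:M *m block_mx 1%:M 1%:M 0 1%:M).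
  by rewrite !mulmx_block ?(mulmx1, mul1mx, mulmx0, mul0mx, addr0, add0r,
    addrN, subrr, addNr, mulmxN).
by rewrite !det_mulmx !det_ublock det_lblock !det1 !mul1r mulr1.
Qed.

(** Squaring removes both the sign of the column permutation and the orientation of the
    differences. *)
Lemma det_Vandermonde_perm (R : comNzRingType) n (x : 'I_n -> R)
    (e : 'I_n -> 'I_n) :
  injective e ->
  (\det (\matrix_(i, j) x i ^+ e j)) ^+ 2 =
  \prod_(i < n) \prod_(j < n | (i < j)%N) (x i - x j) ^+ 2.
Proof.
move=> e_inj; pose V := Vandermonde n (\row_i x i).
have -> : \matrix_(i, j) x i ^+ e j = (row_perm (perm e_inj) V)^T.
  by apply/matrixP => i j; rewrite !mxE permE.
rewrite det_tr row_permE det_mulmx det_perm exprMn sqrr_sign mul1r det_Vandermonde.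
rewrite -prodrXl; apply: eq_bigr => i _; rewrite -prodrXl; apply: eq_bigr => j _.
by rewrite !mxE -sqrrN opprB.
Qed.

Lemma det_unity_diff_expr (R : comNzRingType) h (x : 'I_(h.+1 + h.+1) -> R) :
  (forall i, x i ^+ h.+1.*2 = 1) ->
  \det (\matrix_(i, j) (x i - x j) ^+ h.+1.*2.+1) =
  ((\prod_(i < h.+1 + h.+1) \prod_(j < h.+1 + h.+1 | (i < j)%N) (x i - x j)) *
   (h.+1.*2.+2%:R * \prod_(2 <= r < h.+2) ((-1) ^+ r * 'C(h.+1.*2.+1, r)%:R)))
  ^+ 2.
Proof.
move=> x1.
pose L := \matrix_(i < h.+1 + h.+1, j < h.+1) x i ^+ expL h j.
pose U := \matrix_(i < h.+1 + h.+1, j < h.+1) x i ^+ expR j.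
pose D := diag_mx (\row_(i < h.+1) coefLR R h i).
have -> : \matrix_(i, j) (x i - x j) ^+ h.+1.*2.+1 =
    row_mx L U *m block_mx 0 D (- D) 0 *m (row_mx L U)^T.
  rewrite tr_row_mx mul_row_block !mulmx0 add0r addr0 mul_row_col.
  rewrite mulmxN mulNmx addrC.
  apply/matrixP => i j; rewrite !mxE odd_exprB_unity // -sumrB.
  by apply: eq_bigr => k _; rewrite !mul_mx_diag !mxE; ring.
rewrite !det_mulmx det_tr det_block_antidiag mulrAC -expr2 exprMn; congr (_ * _).
  pose e (i : 'I_(h.+1 + h.+1)) := Ordinal (expLR_ltn i).
  have e_inj : injective e by move=> i j /(congr1 val) /expLR_inj.
  have -> : row_mx L U = \matrix_(i, j) x i ^+ e j.
    apply/matrixP => i j; rewrite !mxE /= /expLR.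
    by case: splitP => k _; rewrite !mxE.
  rewrite det_Vandermonde_perm // -prodrXl.
  by apply: eq_bigr => i _; rewrite -prodrXl.
congr (_ ^+ 2); rewrite det_diag big_ord_recl mxE /=; congr (_ * _).
rewrite (big_addn 0 _ 2) subn2 big_mkord; apply: eq_bigr => i _.
by rewrite mxE /= /bump /= add1n addn2.
Qed.

(** * Euler's criterion and rules for the Legendre symbol *)

Lemma Fp_intr_eq (p : nat) (p_pr : prime p) (a b : int) :
  ((a%:~R : 'F_p) == b%:~R) = (a == b %[mod p])%Z.
Proof. by rewrite eqz_mod_dvd (dvdz_pcharf (pchar_Fp p_pr)) rmorphB subr_eq0. Qed.

Lemma Fp_expX (p : nat) (p_pr : prime p) (u : 'F_p) : u != 0 -> u ^+ p.-1 = 1.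
Proof.
move=> u0; apply: (mulfI u0); rewrite -exprS prednK ?prime_gt0 //.
by rewrite mulr1 -[RHS]expf_card card_Fp.
Qed.

(** Write u as a power z^i of a primitive root z: the hypothesis forces i to be even. *)
Lemma Fp_sqr_euler (p : nat) (p_pr : prime p) (p_odd : odd p) (u : 'F_p) :
  u ^+ p.-1./2 = 1 -> exists x, u = x ^+ 2.
Proof.
have p1 : (0 < p.-1)%N by have := prime_gt1 p_pr; lia.
have /hasP[z _ zP] : has p.-1.-primitive_root (enum [pred x : 'F_p | x != 0]).
  apply: has_prim_root; rewrite ?enum_uniq //.
    by apply/allP => x; rewrite mem_enum unity_rootE => /= /Fp_expX->.
  by rewrite -cardE (cardC1 (0 : 'F_p)) card_Fp.
move=> uh; have p2 : p.-1 = (p.-1./2 * 2)%N by lia.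
have u1 : u ^+ p.-1 = 1 by rewrite p2 exprM uh expr1n.
have [i ui] := prim_rootP zP u1; move: uh; rewrite ui -exprM => /eqP.
rewrite -(prim_order_dvd zP) {1}p2 mulnC dvdn_pmul2r; last by lia.
by move=> /dvdnP[j ->]; exists (z ^+ j); rewrite -exprM.
Qed.

Lemma legendre_euler (p : nat) (p_pr : prime p) (p_odd : odd p) (a : int) :
  (legendre a p)%:~R = a%:~R ^+ p.-1./2 :> 'F_p.
Proof.
have p2 : p.-1 = (p.-1./2 * 2)%N by lia.
have h0 : (p.-1./2 != 0)%N by have := prime_gt1 p_pr; lia.
rewrite /legendre (dvdz_pcharf (pchar_Fp p_pr)).
case: eqP => [->|/eqP a0]; first by rewrite expr0n (negPf h0).
case: existsP => [[x]|nsq].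
  rewrite -Fp_intr_eq // rmorphXn /= => /eqP xa.
  rewrite -xa -exprM mulnC -p2 Fp_expX //.
  by apply: contraNneq a0 => x0; rewrite -xa x0 expr0n.
have : (a%:~R ^+ p.-1./2) ^+ 2 == 1 :> 'F_p by rewrite -exprM -p2 Fp_expX.
rewrite sqrf_eq1 => /orP[/eqP /(Fp_sqr_euler p_pr p_odd)[x ax]|/eqP-> //].
case: nsq; have lt_xp : (x < p)%N by rewrite -[ltnRHS](Fp_cast p_pr).
exists (Ordinal lt_xp); rewrite -Fp_intr_eq // rmorphXn /= ax.
by apply/eqP; congr (_ ^+ 2); apply: natr_Zp.
Qed.

(** By Euler's criterion the two symbols are congruent modulo p; they differ by at most 2 < p, hence
    are equal. *)
Lemma legendre_eq_exp (p : nat) (p_pr : prime p) (p_odd : odd p) (a b : int) :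
  a%:~R ^+ p.-1./2 = b%:~R ^+ p.-1./2 :> 'F_p -> legendre a p = legendre b p.
Proof.
have p3 := odd_prime_gt2 p_odd p_pr.
rewrite -!legendre_euler // => /eqP; rewrite Fp_intr_eq // eqz_mod_dvd dvdzE /=.
have legP c : `|legendre c p| <= 1.
  by rewrite /legendre; case: ifP => // _; case: ifP.
move: (legP a) (legP b); set x := legendre a p; set y := legendre b p.
move=> x1 y1 /dvdn_leq d; apply/eqP; rewrite -subr_eq0 -absz_eq0.
apply/negPn/negP; rewrite -lt0n => /d; lia.
Qed.

Lemma legendreM (p : nat) (p_pr : prime p) (p_odd : odd p) (a b : int) :
  legendre (a * b) p = legendre a p * legendre b p.
Proof.
have p3 := odd_prime_gt2 p_odd p_pr.
have : (legendre (a * b) p)%:~R == (legendre a p * legendre b p)%:~R :> 'F_p.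
  by rewrite rmorphM /= !legendre_euler // rmorphM exprMn.
rewrite Fp_intr_eq // eqz_mod_dvd dvdzE /=.
have legP c : legendre c p \in [:: -1; 0; 1].
  by rewrite /legendre; case: ifP => // _; case: ifP.
move: (legP a) (legP b) (legP (a * b)); rewrite !inE.
by do 3!case/or3P => /eqP ->; rewrite // => /dvdn_leq; lia.
Qed.

Lemma prime_dvd_fact p n : prime p -> (n < p)%N -> (p %| n`!)%N = false.
Proof.
move=> p_pr; elim: n => [|n IHn] lt_np.
  by rewrite fact0 dvdn1 gtn_eqF ?prime_gt1.
by rewrite factS Euclid_dvdM // gtnNdvd //= IHn // ltnW.
Qed.

Lemma legendre_sqr (p : nat) (a : int) : ~~ (p %| a)%Z -> legendre a p ^+ 2 = 1.
Proof. by rewrite /legendre => /negPf->; case: ifP. Qed.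

Lemma legendre_congr (p : nat) (p_pr : prime p) (p_odd : odd p) (a b : int) :
  a%:~R = b%:~R :> 'F_p -> legendre a p = legendre b p.
Proof. by move=> ab; apply: legendre_eq_exp; rewrite ?ab. Qed.

Lemma legendre1 (p : nat) (p_pr : prime p) (p_odd : odd p) : legendre 1 p = 1.
Proof.
have nd : ~~ (p %| 1)%Z by rewrite dvdzE dvdn1 gtn_eqF ?prime_gt1.
by have := legendre_sqr nd; rewrite expr2 -legendreM // mulr1.
Qed.

Lemma legendreX (p : nat) (p_pr : prime p) (p_odd : odd p) (a : int) n :
  legendre (a ^+ n) p = legendre a p ^+ n.
Proof.
by elim: n => [|n IHn]; rewrite ?legendre1 // !exprS legendreM // IHn.
Qed.

Lemma PoszX (b n : nat) : (b ^ n)%N%:Z = b%:Z ^+ n.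
Proof. by rewrite -natz natrX natz. Qed.

(** * Symbols of the binomial product and of the integer root *)

(** Squares drop out of [prod_bin_double_fact], so only the parity of h matters. For odd h one
    factor N! = N (N - 1)!! (N - 2)!! survives, and its (N - 2)!! cancels. *)
Lemma legendre_prod_bin (p h : nat) (p_pr : prime p) (p_odd : odd p) :
  (h.+1.*2.+1 < p)%N ->
  legendre (\prod_(2 <= r < h.+2) 'C(h.+1.*2.+1, r))%N%:Z p =
    if odd h then
      legendre h.+1.*2.+1%:Z p * legendre (double_fact h.+1.*2)%:Z p
    else legendre (double_fact h.*2.+1)%:Z p.
Proof.
move=> ltNp; have Nfact_ndvd : ~~ (p %| (h.+1.*2.+1)`!)%N by rewrite prime_dvd_fact.
have NE : (h.+1.*2.+1)`! =
    (h.+1.*2.+1 * (double_fact h.+1.*2 * double_fact h.*2.+1))%N.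
  by rewrite factS fact_double_fact.
have ndvd_W : ~~ (p %| double_fact h.*2.+1)%N.
  by apply: contra Nfact_ndvd => d; rewrite NE !dvdn_mull.
have := prod_bin_double_fact h.
move: (\prod_(2 <= _ < _) _)%N (\prod_(1 <= _ < _) _)%N => Q B QBW.
have ndvd_B : ~~ (p %| B)%N.
  apply: contra Nfact_ndvd => d.
  have : (p %| (h.+1.*2.+1)`! ^ h)%N
    by rewrite -QBW dvdn_mull // dvdn_mulr // dvdn_exp.
  by rewrite Euclid_dvdX // => /andP[].
have B1 : legendre B%:Z p ^+ 2 = 1 by apply: legendre_sqr; rewrite dvdzE.
have W1 : legendre (double_fact h.*2.+1)%:Z p ^+ 2 = 1.
  by apply: legendre_sqr; rewrite dvdzE.
have N1 : legendre (h.+1.*2.+1)`!%:Z p ^+ 2 = 1.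
  by apply: legendre_sqr; rewrite dvdzE.
have : legendre (Q * (B ^ 2 * double_fact h.*2.+1))%N%:Z p =
    legendre ((h.+1.*2.+1)`! ^ h)%N%:Z p by rewrite QBW.
rewrite 2!PoszM !PoszX legendreM // legendreM // !legendreX // B1 mul1r.
move=> /(congr1 ( *%R^~ (legendre (double_fact h.*2.+1) p))).
rewrite -mulrA -expr2 W1 mulr1 => ->.
have -> : legendre (h.+1.*2.+1)`! p ^+ h =
    if odd h then legendre (h.+1.*2.+1)`! p else 1.
  rewrite -[X in _ ^+ X]odd_double_half exprD -[h./2.*2]mul2n.
  rewrite exprM N1 expr1n mulr1.
  by case: (odd h).
case: (odd h); last by rewrite mul1r.
by rewrite NE !PoszM legendreM // legendreM // -!mulrA -expr2 W1 mulr1.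
Qed.

Lemma legendre_sqrt_S (p h : nat) (p_pr : prime p) (p4 : (p = 1 %[mod 4])%N)
    (alpha : 'I_(h.+1 + h.+1) -> int) :
  (forall i, (alpha i)%:~R ^+ h.+1.*2 = 1 :> 'F_p) ->
  legendre (sqrtz (S_det alpha h.+1.*2.+1 (-1))) p =
    legendre (T_prod alpha) p * (legendre h.+1.*2.+2%:Z p *
      legendre (\prod_(2 <= r < h.+2) 'C(h.+1.*2.+1, r))%N%:Z p).
Proof.
move=> alpha1; have p_odd : odd p by lia.
have [s Ss] : exists s, S_det alpha h.+1.*2.+1 (-1) = s ^+ 2.
  apply: det_skew_int_square; apply/matrixP => i j; rewrite !mxE !mulN1r.
  by rewrite -[alpha j - _]opprB exprNn -signr_odd /= odd_double mulN1r.
(* As (p - 1)/2 is even, signs vanish in Euler's criterion: the (-1)^r as well as the choice of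
   square root. *)
have sgnX r : ((-1) ^+ r) ^+ p.-1./2 = 1 :> 'F_p.
  by rewrite -exprM -signr_odd oddM (_ : odd p.-1./2 = false) ?andbF //; lia.
have normX : `|s|%:~R ^+ p.-1./2 = s%:~R ^+ p.-1./2 :> 'F_p.
  rewrite -abszE [in RHS](intEsign s) rmorphM rmorphXn rmorphN1.
  by rewrite exprMn sgnX mul1r.
have : s%:~R ^+ 2 == ((T_prod alpha)%:~R * (h.+1.*2.+2%:R *
    \prod_(2 <= r < h.+2) ((-1) ^+ r * 'C(h.+1.*2.+1, r)%:R))) ^+ 2 :> 'F_p.
  rewrite -rmorphXn -Ss /S_det -det_map_mx /=.
  have -> : (T_prod alpha)%:~R = \prod_(i < h.+1 + h.+1)
     \prod_(j < h.+1 + h.+1 | (i < j)%N) ((alpha i)%:~R - (alpha j)%:~R) :> 'F_p.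
    rewrite rmorph_prod; apply: eq_bigr => i _; rewrite rmorph_prod.
    by apply: eq_bigr => j _; rewrite rmorphB.
  rewrite -det_unity_diff_expr //; apply/eqP; congr (\det _).
  by apply/matrixP => i j; rewrite !mxE rmorphXn rmorphD mulN1r rmorphN.
rewrite eqf_sqr Ss sqrtz_sqr -!legendreM // => sE; apply: legendre_eq_exp => //.
rewrite normX.
have pmX (a t c q : 'F_p) : (a == t * (c * q)) || (a == - (t * (c * q))) ->
    a ^+ p.-1./2 = t ^+ p.-1./2 * (c ^+ p.-1./2 * q ^+ p.-1./2).
  rewrite -!exprMn => /orP[/eqP->|/eqP->] //.
  by rewrite exprNn -[in X in X * _](expr1 (-1)) sgnX mul1r.
rewrite (pmX _ _ _ _ sE) 2!rmorphM 2!exprMn; congr (_ * (_ * _)).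
rewrite big_split exprMn /= -prodrXl big1 ?mul1r; last by move=> r _; apply: sgnX.
by rewrite -[in RHS]pmulrn natr_prod.
Qed.

Theorem theorem1p9 (p k : nat) (alpha : 'I_((p - 1) %/ k) -> int)
  (p_prime : prime p) (p_odd : odd p)
  (k_bounds : (2 <= k <= (p - 1) %/ 2)%N)
  (p_mod : (p = 1 %[mod 2 * k])%N)
  (alphaP : lists_kth_power_residues p k alpha) :
  let m := ((p - 1) %/ k)%N in
  let sqrtS := sqrtz (S_det alpha (1 + m) (-1)) in
  let T := T_prod alpha in
  ((p = 1 %[mod 4 * k])%N ->
     legendre sqrtS p =
       legendre ((k%:Z - 1) * (2 * k%:Z - 1)) p
         * legendre (double_fact m)%:Z p * legendre T p)
  /\
  (~~ odd k -> (p = 2 * k + 1 %[mod 4 * k])%N ->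
     legendre sqrtS p =
       if p == (2 * k + 1)%N then legendre T p
       else legendre (k%:Z * (2 * k%:Z - 1)) p
              * legendre (double_fact (m - 1))%:Z p * legendre T p).
Proof.
have [k2 kp] := andP k_bounds; have p_gt1 := prime_gt1 p_prime.
have /dvdnP[H pH] : (2 * k %| p - 1)%N by rewrite -eqn_mod_dvd ?p_mod // ltnW.
have H0 : (0 < H)%N by lia.
case: H H0 pH => // h _ pH.
have mE : ((p - 1) %/ k = h.+1 + h.+1)%N.
  by rewrite pH (_ : h.+1 * (2 * k) = (h.+1 + h.+1) * k)%N ?mulnK //; lia.
have pE : (p - 1 = h.+1.*2 * k)%N by rewrite pH; lia.
(* Since k is at least 2, N = m + 1 stays below p, so p does not divide N!. *)
have ltNp : (h.+1.*2.+1 < p)%N by nia.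
(* A k-th power x^k satisfies (x^k)^m = x^(p - 1) = 1. *)
have alpha1 i : (alpha i)%:~R ^+ h.+1.*2 = 1 :> 'F_p.
  have [nd [x /eqP]] : kth_power_residue p k (alpha i).
    by apply/alphaP.2; exists i.
  rewrite -Fp_intr_eq // rmorphXn /= => /eqP xk.
  move: nd; rewrite (dvdz_pcharf (pchar_Fp p_prime)) -xk => nz.
  rewrite -exprM mulnC -pE subn1 Fp_expX //.
  by apply: contraNneq nz => ->; rewrite expr0n gtn_eqF // ltnW.
move: alpha alphaP alpha1; rewrite mE => alpha _ alpha1 m sqrtS T.
have legk : legendre k%:Z p ^+ 2 = 1.
  by apply: legendre_sqr; rewrite dvdzE /= gtnNdvd //; lia.
have p0 : p%:R = 0 :> 'F_p by apply: pchar_Fp_0.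
(* From k m = p - 1 follows k (m + c) = (c k - 1) + p. It serves with c = 1 for m + 1 and c = 2 for
   m + 2. *)
have kmul c :
    legendre (c * k%:Z - 1) p = legendre k%:Z p * legendre (h.+1.*2%:Z + c) p.
  rewrite -legendreM //; apply: legendre_congr => //.
  have -> : k%:Z * (h.+1.*2%:Z + c) = (c * k%:Z - 1) + p%:Z by lia.
  by rewrite [in RHS]rmorphD /= -pmulrn p0 addr0.
have m2 : m = h.+1.*2 by rewrite /m addnn.
rewrite /sqrtS m2 add1n.
have sqrtE (p4 : (p = 1 %[mod 4])%N) := legendre_sqrt_S p_prime p4 alpha1.
split=> [pk|k_even pk].
  have dvd4k : (4 * k %| p - 1)%N by rewrite -eqn_mod_dvd ?pk // ltnW.
  (* Here 4k divides p - 1 = 2 (h + 1) k, so h + 1 is even. *)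
  have h_odd : odd h.
    by move: dvd4k; rewrite pE dvdn_pmul2r ?(ltnW k2) //; clear; lia.
  rewrite sqrtE; last first.
    apply/eqP; rewrite eqn_mod_dvd ?(ltnW p_gt1) //.
    by apply: dvdn_trans dvd4k; apply: dvdn_mulr.
  rewrite legendre_prod_bin // h_odd legendreM //.
  rewrite -{1}[k%:Z]mul1r !kmul -!PoszD addn1 addn2.
  by rewrite -[LHS]mul1r -legk; ring.
(* Here 4k divides p - (2k + 1) = 2hk. *)
have h_even : odd h = false.
  have : (4 * k %| h.*2 * k)%N.
    have -> : (h.*2 * k = p - (2 * k + 1))%N by clear -pE; lia.
    by rewrite -eqn_mod_dvd ?pk //; clear -pE p_gt1; lia.
  by rewrite dvdn_pmul2r ?(ltnW k2) //; clear; lia.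
(* That 4 divides p - 1 = m k comes from m and k both being even. *)
rewrite sqrtE; last first.
  apply/eqP; rewrite eqn_mod_dvd ?(ltnW p_gt1) // pE.
  by apply: (@dvdn_mul 2 2); rewrite dvdn2 ?odd_double.
rewrite legendre_prod_bin // h_even; case: eqP => [pk1|_].
  (* If p = 2k + 1 then m = 2: m + 2 = 4 is a square and (m - 1)!! = 1, so only the symbol of T
     remains. *)
  have : (h.+1.*2 * k == 2 * k)%N by clear -pE pk1; lia.
  rewrite eqn_pmul2r ?(ltnW k2) // => /eqP; rewrite doubleS => -[h0].
  have [-> ->] : h.+1.*2.+2 = 4 /\ h.*2.+1 = 1%N by rewrite doubleS h0.
  rewrite (PoszX 2 2) legendreX // legendre_sqr ?mul1r ?legendre1 ?mulr1 //.
  by rewrite dvdzE /= gtnNdvd //; clear -pk1 k2; lia.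
rewrite legendreM // kmul -PoszD addn2 doubleS subn1 [_.+2.-1]/=.
by rewrite -[LHS]mul1r -legk; ring.
Qed.
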